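(* Let $F:\mathbb{R}^2\to\mathbb{R}^2$ be a polynomial map, and let $N_1,N_2$ be the nonlinear parts of its two coordinates. If the quotient of $N_1$ and $N_2$ is not constant, then there exists a point in $\mathbb{R}^2$ at which the Jacobian matrix of $F$ has a (complex) eigenvalue outside the unit disk.
   Context: A polynomial map is a map whose two coordinate functions are real polynomials in $(x,y)$. The nonlinear part of a coordinate $F_i$ of $F=(F_1,F_2)$ is the polynomial $N_i$ obtained from $F_i$ by removing its terms of degree at most one, so $(N_1,N_2)^T=F(x,y)-F(0,0)-JF(0,0)(x,y)^T$, where $JF$ is the Jacobian matrix. ''The quotient is not constant'' means that $N_1,N_2$ are nonzero polynomials and the rational function $N_1/N_2$ is not a constant, i.e. $N_1$ and $N_2$ are linearly independent over $\mathbb{R}$. The unit disk is $\{z\in\mathbb{C}:|z|<1\}$, so an eigenvalue $\lambda$ is outside the unit disk when $|\lambda|\ge 1$. *)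

(* Defs.v *)
From HB Require Import structures.
From mathcomp Require Import all_boot all_order all_algebra fraction.
From mathcomp Require Import reals.
From mathcomp Require Import complex.
From mathcomp.multinomials Require Import mpoly.

Set Implicit Arguments.
Unset Strict Implicit.
Unset Printing Implicit Defensive.

Import Order.TTheory GRing.Theory Num.Theory.

Local Open Scope ring_scope.
Local Open Scope complex_scope.

(* A polynomial map of R^n is the family F : 'I_n -> {mpoly R[n]} of its
   coordinate polynomials; at a point v it takes the value i |-> (F i).@[v].
   Over an infinite field the polynomials are determined by that function. *)

Definition nonlinear_part (R : comNzRingType) (n : nat) (p : {mpoly R[n]}) :
    {mpoly R[n]} :=
  \sum_(m <- msupp p | (1 < mdeg m)%N) p@_m *: 'X_[m].

Definition jacobian_mx (R : comNzRingType) (n : nat)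
    (F : 'I_n -> {mpoly R[n]}) (v : 'I_n -> R) : 'M[R]_n :=
  \matrix_(i, j) ((F i)^`M(j)).@[v].

(* p / q is formed in the field of rational functions, the fraction field of
   {mpoly R[n]}. *)
Definition nonconstant_quotient (R : idomainType) (n : nat)
    (p q : {mpoly R[n]}) : Prop :=
  [/\ p != 0, q != 0 &
      forall c : R, tofrac p / tofrac q <> tofrac c%:MP_[n]].

(* Main.v *)
(* If every eigenvalue lay in the open unit disk, the trace and the determinant of
   the Jacobian would be bounded polynomials, hence constants. Subtracting t/2 times
   the identity makes the field divergence-free, i.e. of the form (H_y, -H_x), and
   the Hessian determinant of H is a constant. Every vertex of the Newton polygon of
   H lying off the axes contributes a nonzero term to the Hessian, so unless H_x or
   H_y is affine the polygon is bounded by a segment from y^r to x^n. The monomial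
   next to y^r on this segment must be x y^j, the one next to x^n must be x^i y, so
   n = r. Conjugating F by a shear removes x y^(n-1), which forces a linear
   combination of the two coordinates to be affine, i.e. proportional nonlinear
   parts. *)

Require Import Defs.
From mathcomp Require Import all_boot all_order all_algebra fraction.
From mathcomp Require Import reals.
From mathcomp Require Import complex polyrcf.
From mathcomp.multinomials Require Import mpoly.
From mathcomp Require Import ring zify.

Set Implicit Arguments.
Unset Strict Implicit.
Unset Printing Implicit Defensive.

Import Order.TTheory GRing.Theory Num.Theory.

Local Open Scope ring_scope.
Local Open Scope complex_scope.

(** * Exponents in two variables and lexicographic maxima *)

Lemma ord2_cases (k l i : 'I_2) : k != l -> i = k \/ i = l.
Proof.
by case: k l i => [[|[|k]] hk] [[|[|l]] hl] [[|[|i]] hi] //= _;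
  [left|right|right|left]; apply: val_inj.
Qed.

Lemma mnm2P (k l : 'I_2) (m m' : 'X_{1..2}) :
  k != l -> m k = m' k -> m l = m' l -> m = m'.
Proof.
by move=> kl ek el; apply/mnmP => i; have [->|->] := ord2_cases i kl.
Qed.

Lemma mdeg2E (k l : 'I_2) (m : 'X_{1..2}) : k != l -> mdeg m = (m k + m l)%N.
Proof.
move=> kl; rewrite mdegE (bigD1 k) //= (bigD1 l) 1?eq_sym //= big1 ?addn0 //.
by move=> i; have [->|->] := ord2_cases i kl; rewrite eqxx ?andbF.
Qed.

Lemma seq_max (T : eqType) (f : T -> nat) (s : seq T) (x0 : T) :
  x0 \in s -> exists2 x, x \in s & forall y, y \in s -> (f y <= f x)%N.
Proof.
elim: s x0 => // a [|b s] IH x0 _.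
  by exists a => [|y]; rewrite inE ?eqxx // => /eqP ->.
have [x xs hx] := IH b (mem_head _ _).
have [le|lt] := leqP (f a) (f x).
  by exists x => [|y]; rewrite inE ?xs ?orbT // => /predU1P[->|/hx].
exists a => [|y]; rewrite inE ?eqxx // => /predU1P[->//|/hx h].
exact: leq_trans h (ltnW lt).
Qed.

(** For two independent linear forms on exponents, the first picks a supporting line of the Newton
    polygon and the second an end of the edge on it. *)
Lemma seq_lexmax (T : eqType) (f g : T -> nat) (s : seq T) (x0 : T) :
  x0 \in s -> exists2 x, x \in s &
    forall y, y \in s -> (f y <= f x)%N /\ (f y = f x -> (g y <= g x)%N).
Proof.
move=> /(seq_max f)[x xs hx].
have xin : x \in [seq y <- s | f y == f x] by rewrite mem_filter eqxx.
have [z] := seq_max g xin; rewrite mem_filter => /andP[/eqP fz zs] hz.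
exists z => // y ys; rewrite fz; split; first exact: hx.
by move=> fy; apply: hz; rewrite mem_filter ys fy eqxx.
Qed.

(** * Coefficients, Euler operators and affine polynomials *)

Section Mpoly.
Variables (R : comNzRingType) (n : nat).
Implicit Types (p q : {mpoly R[n]}) (m : 'X_{1..n}) (i j : 'I_n).

Lemma mnm_split m :
  (0 < mdeg m)%N -> exists i m', m = (m' + U_(i))%MM.
Proof.
have [->|] := eqVneq m 0%MM; first by rewrite mdeg0.
move=> m0 _; have [i mi] : exists i, m i != 0%N.
  apply/existsP; apply: contraNT m0 => /existsPn h.
  by apply/eqP/mnmP => i; rewrite mnm0E; apply/eqP; rewrite -[_ == _]negbK.
by exists i, (m - U_(i))%MM; rewrite submK // lep1mP.
Qed.

Lemma mderivXX (i j : 'I_n) : ('X_i : {mpoly R[n]})^`M(j) = (i == j)%:R.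
Proof.
rewrite mderivX mnm1E; case: eqP => [->|_]; last by rewrite scale0r.
by rewrite scale1r -{1}[U_(j)%MM]add0m addmK mpolyX0.
Qed.

(** The zero case is separate because subtraction of exponents truncates: there [m - U_(i)] would be
    [m] itself. *)
Lemma mcoeffXUM p i m :
  ('X_i * p)@_m = if m i == 0%N then 0 else p@_(m - U_(i)).
Proof.
have [mi0|mi0] := eqVneq (m i) 0%N.
  rewrite mcoeffM big1 // => -[a b] /= /eqP mE; rewrite mcoeffX.
  case: eqP => [aE|]; last by rewrite mul0r.
  by move: (congr1 (fun m' : 'X_{1..n} => m' i) mE); rewrite mi0 mnmDE -aE mnm1E eqxx.
have {1}-> : m = (U_(i) + (m - U_(i)))%MM.
  by rewrite addmC submK // lep1mP.
by rewrite mulrC mcoeffMX.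
Qed.

(** Euler operators are diagonal on monomials, so products of them expand without shifts of
    exponents. *)
Lemma mcoeff_euler p i m :
  ('X_i * p^`M(i))@_m = p@_m * (m i)%:R.
Proof.
rewrite mcoeffXUM; case: eqP => [->|/eqP mi0]; first by rewrite mulr0.
rewrite mcoeff_deriv submK ?lep1mP // mnmBE mnm1E eqxx.
by rewrite subn1 prednK ?lt0n // mulr_natr.
Qed.

Lemma mpoly_alg_ind (P : {mpoly R[n]} -> Prop) :
  (forall c, P c%:MP) -> (forall i, P 'X_i) ->
  (forall p q : {mpoly R[n]}, P p -> P q -> P (p + q)) ->
  (forall p q : {mpoly R[n]}, P p -> P q -> P (p * q)) -> forall p : {mpoly R[n]}, P p.
Proof.
move=> PC PX PD PM p; rewrite [p]mpolyE.
have P0 : P 0 by rewrite -mpolyC0; apply: PC.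
have P1 : P 1 by rewrite -mpolyC1; apply: PC.
apply: big_ind => // m _; rewrite -mul_mpolyC; apply: (PM) => //.
rewrite mpolyXE_id; apply: big_ind => // i _.
by move: (m i); elim=> [|e IH]; rewrite ?expr0 // exprS; apply: PM.
Qed.

Definition affine p : Prop := forall m, (1 < mdeg m)%N -> p@_m = 0.

Lemma affineD p q : affine p -> affine q -> affine (p + q).
Proof. by move=> hp hq m m1; rewrite mcoeffD hp // hq // addr0. Qed.

Lemma affineN p : affine p -> affine (- p).
Proof. by move=> hp m m1; rewrite mcoeffN hp // oppr0. Qed.

Lemma affineZX (a : R) i : affine (a *: 'X_i : {mpoly R[n]}).
Proof.
move=> m m1; rewrite mcoeffZ mcoeffX; case: eqP => [mE|]; last by rewrite mulr0.
by move: m1; rewrite -mE mdeg1.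
Qed.

Lemma mcoeff_nonlinear_part p m :
  (nonlinear_part p)@_m = if (1 < mdeg m)%N then p@_m else 0.
Proof.
rewrite /nonlinear_part raddf_sum /=; case: ifP => m1; last first.
  rewrite big1 // => m' m'1; rewrite mcoeffZ mcoeffX.
  by case: eqP m'1 => [->|_ _]; rewrite ?m1 ?mulr0.
rewrite -big_filter; have [ms|ms] := boolP (m \in [seq m' <- msupp p | (1 < mdeg m')%N]).
  rewrite (bigD1_seq m) ?filter_uniq ?msupp_uniq //= mcoeffZ mcoeffX eqxx mulr1.
  rewrite big1 ?addr0 // => m' m'm; rewrite mcoeffZ mcoeffX (negPf m'm) mulr0 //.
rewrite big_seq big1 => [|m' m's].
  by move: ms; rewrite mem_filter m1 /= => /memN_msupp_eq0.
rewrite mcoeffZ mcoeffX; case: eqP => [m'm|]; last by rewrite mulr0.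
by rewrite m'm (negPf ms) in m's.
Qed.

Lemma nonlinear_part_affine p :
  affine p -> nonlinear_part p = 0.
Proof.
move=> hp; apply/mpolyP => m; rewrite mcoeff_nonlinear_part mcoeff0.
by case: ifP => // /hp.
Qed.

End Mpoly.

(** * The Hessian as a quadratic form in the coefficients *)

Section ConstantHessian.
Variable R : numFieldType.
Implicit Types (H p q : {mpoly R[2]}) (m v : 'X_{1..2}) (k l : 'I_2).

Definition hessian k l H : {mpoly R[2]} :=
  H^`M(k)^`M(k) * H^`M(l)^`M(l) - H^`M(k)^`M(l) ^+ 2.

Lemma hessianC k l H : hessian k l H = hessian l k H.
Proof. by rewrite /hessian mulrC (mderiv_comm k l). Qed.

(* The bilinear weight of the pair of monomials [X^m], [X^m'] in
   [x^2 y^2 (H_xx H_yy - H_xy^2)]. *)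
Definition hess_weight k l m m' : R :=
  (m k)%:R * ((m k)%:R - 1) * ((m' l)%:R * ((m' l)%:R - 1))
  - (m k)%:R * (m l)%:R * ((m' k)%:R * (m' l)%:R).

(** The factor $x^2y^2$ turns every derivative into Euler operators: $x^2 H_{xx} = E_x(E_x - 1)H$
    and $xy H_{xy} = E_y E_x H$. *)
Lemma mcoeff_hessian k l H m : k != l ->
  (('X_k * 'X_l) ^+ 2 * hessian k l H)@_m =
  \sum_(d : 'X_{1..2 < (mdeg m).+1, (mdeg m).+1} | m == (d.1 + d.2)%MM)
     hess_weight k l d.1 d.2 * (H@_d.1 * H@_d.2).
Proof.
move=> kl.
pose E i p : {mpoly R[2]} := 'X_i * p^`M(i).
have XE i : ('X_i : {mpoly R[2]})^`M(i) = 1.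
  by rewrite mderivX mnm1E eqxx scale1r -{1}[U_(i)%MM]add0m addmK mpolyX0.
have Eii i p : 'X_i ^+ 2 * p^`M(i)^`M(i) = E i (E i p) - E i p.
  by rewrite /E mderivM XE; ring.
have Ekl : 'X_k * 'X_l * H^`M(k)^`M(l) = E l (E k H).
  by rewrite /E mderivM mderivX mnm1E (negPf kl) scale0r; ring.
have -> : ('X_k * 'X_l) ^+ 2 * hessian k l H =
    (E k (E k H) - E k H) * (E l (E l H) - E l H) - E l (E k H) * E l (E k H).
  by rewrite -!Eii -Ekl /hessian; ring.
rewrite mcoeffB !mcoeffM -sumrB; apply: eq_bigr => d _.
rewrite !mcoeffB !mcoeff_euler /hess_weight; ring.
Qed.

End ConstantHessian.

(** * Newton polygons of polynomials with constant Hessian *)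

Section NewtonPolygon.
Variables (R : numFieldType) (c : R) (H : {mpoly R[2]}).
Implicit Types (m v : 'X_{1..2}) (k l : 'I_2).

(** After multiplication by $x^2y^2$ a constant Hessian lives at exponent $(2,2)$ alone. Every other
    coefficient vanishes, and if a single ordered pair contributes to it, so does the term of that
    pair. *)
Lemma hess_coef_single k l (a b : 'X_{1..2}) : k != l ->
  hessian k l H = c%:MP -> (a + b)%MM != ((U_(k) + U_(l)) *+ 2)%MM ->
  (forall m m', m \in msupp H -> m' \in msupp H -> (m + m')%MM = (a + b)%MM ->
     hess_weight R k l m m' != 0 -> m = a) ->
  hess_weight R k l a b * (H@_a * H@_b) = 0.
Proof.
move=> kl hc ab uniq.
have := mcoeff_hessian H (a + b)%MM kl.
rewrite hc -mpolyXD mpolyXn mulrC mul_mpolyC mcoeffZ mcoeffX eq_sym (negPf ab).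
rewrite mulr0 => ->.
have la : (mdeg a < (mdeg (a + b)).+1)%N by rewrite mdegD ltnS leq_addr.
have lb : (mdeg b < (mdeg (a + b)).+1)%N by rewrite mdegD ltnS leq_addl.
rewrite (bigD1 (BMultinom la, BMultinom lb)) //= big1 ?addr0 // => -[d1 d2] /=.
case/andP=> /eqP dE /negP dne.
have [->|w0] := eqVneq (hess_weight R k l d1 d2) 0; first by rewrite mul0r.
have [d1s|/memN_msupp_eq0 ->] := boolP (bmnm d1 \in msupp H); last by rewrite mul0r mulr0.
have [d2s|/memN_msupp_eq0 ->] := boolP (bmnm d2 \in msupp H); last by rewrite !mulr0.
case: dne; have d1a := uniq _ _ d1s d2s (esym dE) w0.
have d2b : bmnm d2 = b.
  by exact: (@addmI _ a) (etrans (congr1 (fun m => m + bmnm d2)%MM (esym d1a)) (esym dE)).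
by rewrite xpair_eqE -!val_eqE /= d1a d2b !eqxx.
Qed.

Definition weight k l (A B : nat) m := (A * m k + B * m l)%N.

Lemma weightD k l A B m m' :
  weight k l A B (m + m')%MM = (weight k l A B m + weight k l A B m')%N.
Proof. by rewrite /weight !mnmDE; lia. Qed.

(* A vertex of the Newton polygon off the axes contributes
   [-ij(i+j-1)] times the square of its coefficient to the Hessian. *)
Lemma hess_vertex k l A B A' B' v : k != l -> hessian k l H = c%:MP ->
  v \in msupp H -> (0 < v k)%N -> (0 < v l)%N ->
  (forall m, m \in msupp H -> (weight k l A B m <= weight k l A B v)%N /\
     (weight k l A B m = weight k l A B v ->
      (weight k l A' B' m <= weight k l A' B' v)%N)) ->
  (forall m, weight k l A B m = weight k l A B v ->
     weight k l A' B' m = weight k l A' B' v -> m = v) ->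
  v k = 1%N /\ v l = 1%N.
Proof.
move=> kl hc vs vk vl vmax vuniq.
(* The one exponent where the Hessian may survive; it gives the exceptional vertex $xy$. *)
have [/eqP vv|vv] := boolP ((v + v)%MM == ((U_(k) + U_(l)) *+ 2)%MM).
  have lk : (l == k) = false by rewrite eq_sym (negPf kl).
  have := congr1 (fun m : 'X_{1..2} => (m k, m l)) vv.
  by rewrite !(mulmS, mulm0n, addm0, mnmDE, mnm1E) eqxx lk (negPf kl) => -[]; lia.
have uniq m m' : m \in msupp H -> m' \in msupp H -> (m + m')%MM = (v + v)%MM ->
    hess_weight R k l m m' != 0 -> m = v.
  move=> ms ms' mm' _.
  (* Both weights are additive and maximal at [v], in lexicographic order, so [m] and [m'] must
     attain the maxima too. *)
  have := weightD k l A B m m'; have := weightD k l A' B' m m'.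
  rewrite mm' !weightD; have [] := vmax _ ms; have [] := vmax _ ms'.
  move=> h1 h2 h3 h4 e1 e2.
  have e3 : weight k l A B m = weight k l A B v by lia.
  have e4 : weight k l A B m' = weight k l A B v by lia.
  by apply: vuniq => //; move: (h2 e4) (h4 e3); lia.
have /eqP := hess_coef_single kl hc vv uniq.
rewrite mulf_eq0 -expr2 sqrf_eq0 (mcoeff_eq0 H v) vs orbF /hess_weight.
set i := v k in vk *; set j := v l in vl *.
have -> : i%:R * (i%:R - 1) * (j%:R * (j%:R - 1)) - i%:R * j%:R * (i%:R * j%:R) =
   - (i * j * (i + j).-1)%:R :> R.
  rewrite !natrM; have -> : ((i + j).-1)%:R = i%:R + j%:R - 1 :> R.
    by rewrite -natrD -[in RHS](prednK (ltn_addr j vk)) -natr1 addrK.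
  by ring.
rewrite oppr_eq0 pnatr_eq0 !muln_eq0; lia.
Qed.

Lemma weight_lexmax k l A B A' B' m0 : m0 \in msupp H ->
  exists2 v, v \in msupp H & forall m, m \in msupp H ->
    (weight k l A B m <= weight k l A B v)%N /\
     (weight k l A B m = weight k l A B v ->
      (weight k l A' B' m <= weight k l A' B' v)%N).
Proof. exact: seq_lexmax. Qed.

(** Maximise the exponent of $X_k$, then that of $X_l$. The vertex found lies on an axis or is $X_k
    X_l$, so $X_k$ occurs at most to the first power, and then multiplied by at most $X_l$. *)
Lemma affine_deriv_of_pure k l : k != l -> hessian k l H = c%:MP ->
  (forall m, m \in msupp H -> m l = 0%N -> (m k <= 1)%N) ->
  affine H^`M(k).
Proof.
move=> kl hc pure.
case E : (msupp H) => [|m0 s].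
  by move=> m _; rewrite mcoeff_deriv memN_msupp_eq0 ?mul0rn // E.
have m0s : m0 \in msupp H by rewrite E mem_head.
have [v vs vmax] := weight_lexmax k l 1 0 0 1 m0s.
have [vk1 vl1] : (v k <= 1 /\ (0 < v k -> v l <= 1))%N.
  have [vl0|vl0] := posnP (v l); first by rewrite vl0; split; auto.
  have [vk0|vk0] := posnP (v k); first by rewrite vk0.
  have [|->->] // := hess_vertex kl hc vs vk0 vl0 vmax.
  by move=> m; rewrite /weight => e1 e2; apply: (mnm2P kl); lia.
move=> m m1; rewrite mcoeff_deriv; apply/eqP.
rewrite mulrn_eq0 /= mcoeff_eq0; apply/negP => ms.
have [] := vmax _ ms; rewrite /weight !mnmDE !mnm1E eqxx (negPf kl).
by move: m1; rewrite (mdeg2E _ kl); lia.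
Qed.

(** That is, the restriction of [H] to $X_l = 0$ is nonzero of degree [n] in $X_k$. *)
Definition pure_deg k l (n : nat) : Prop :=
  (exists2 m, m \in msupp H & m k = n /\ m l = 0%N) /\
  (forall m, m \in msupp H -> m l = 0%N -> (m k <= n)%N).

Lemma pure_degP k l : k != l -> hessian k l H = c%:MP ->
  affine H^`M(k) \/ exists2 n, (2 <= n)%N & pure_deg k l n.
Proof.
move=> kl hc.
case: (boolP (has (fun m : 'X_{1..2} => (m l == 0) && (1 < m k))%N (msupp H))); last first.
  move/hasPn => h; left; apply: (affine_deriv_of_pure kl hc) => m /h.
  by rewrite negb_and -leqNgt => /orP[/eqP //|//].
case/hasP => m0 m0s /andP[/eqP m0l m0k]; right.
have m0f : m0 \in [seq m : 'X_{1..2} <- msupp H | m l == 0%N].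
  by rewrite mem_filter m0l eqxx.
have [v] := seq_max (fun m : 'X_{1..2} => m k) m0f.
rewrite mem_filter => /andP[/eqP vl vs] vmax.
exists (v k); first exact: leq_trans m0k (vmax _ m0f).
split; first by exists v.
by move=> m ms ml; apply: vmax; rewrite mem_filter ml eqxx.
Qed.

(** A monomial above the line from $X_k^n$ to $X_l^r$ would yield a vertex off the axes above it,
    hence $X_k X_l$; but $n + r \le nr$ for $n, r \ge 2$. *)
Lemma newton_under_line k l n r : k != l -> hessian k l H = c%:MP ->
  (2 <= n)%N -> (2 <= r)%N -> pure_deg k l n -> pure_deg l k r ->
  forall m, m \in msupp H -> (weight k l r n m <= n * r)%N.
Proof.
move=> kl hc n2 r2 [_ kmax] [_ lmax] m0 m0s.
have [v vs vmax] := weight_lexmax k l r n 1 0 m0s.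
suff le : (weight k l r n v <= n * r)%N by apply: leq_trans le; have [] := vmax _ m0s.
rewrite leqNgt; apply/negP => lt.
have [vk0|vk0] := posnP (v k).
  by move: lt (lmax _ vs vk0); rewrite /weight vk0; nia.
have [vl0|vl0] := posnP (v l).
  by move: lt (kmax _ vs vl0); rewrite /weight vl0; nia.
have [|vk1 vl1] // := hess_vertex kl hc vs vk0 vl0 vmax.
  move=> m; rewrite /weight => e1 e2; apply: (mnm2P kl); first by lia.
  have e : m k = v k by lia.
  by move: e1; rewrite e => /addnI/eqP; rewrite eqn_pmul2l ?(ltnW n2) // => /eqP.
by move: lt; rewrite /weight vk1 vl1; nia.
Qed.

(* Along the edge from [y^r] to [x^n], the monomial [x^i y^j] next to [y^r]
   meets only [y^r] in the coefficient of [x^(i-2) y^(r+j-2)] of the Hessian,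
   with weight [i(i-1)r(r-1)]; hence [i = 1]. *)
Lemma newton_edge_neighbour k l n r : k != l -> hessian k l H = c%:MP ->
  (2 <= n)%N -> (2 <= r)%N -> pure_deg k l n -> pure_deg l k r ->
  (n = 2 /\ r = 2)%N \/
  exists2 v, v \in msupp H & v k = 1%N /\ weight k l r n v = (n * r)%N.
Proof.
move=> kl hc n2 r2 pk pl.
have under := newton_under_line kl hc n2 r2 pk pl.
have [[b bs [bk bl]] _] := pk; have [[a as_ [al ak]] _] := pl.
pose edge := [seq m : 'X_{1..2} <- msupp H |
    (weight k l r n m == n * r)%N && (m k != 0%N)].
have bedge : b \in edge by rewrite mem_filter bs /weight bk bl; apply/andP; lia.
(* Maximising [n - m k] minimises [m k]; truncation is harmless since [m k <= n] on the edge. *)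
have [v] := seq_max (fun m : 'X_{1..2} => n - m k)%N bedge.
rewrite mem_filter => /andP[/andP[/eqP vw vk0] vs] vmin.
have [vk1|vk1] := eqVneq (v k) 1%N; first by right; exists v.
left.
(* If [v + a] is $(2,2)$, the equation of the line leaves only [n = r = 2]. *)
have [/eqP va|va] := boolP ((v + a)%MM == ((U_(k) + U_(l)) *+ 2)%MM).
  have lk : (l == k) = false by rewrite eq_sym (negPf kl).
  have := congr1 (fun m : 'X_{1..2} => (m k, m l)) va.
  rewrite !(mulmS, mulm0n, addm0, mnmDE, mnm1E) eqxx lk (negPf kl) al ak => -[].
  by move: vw; rewrite /weight; nia.
have uniq m m' : m \in msupp H -> m' \in msupp H -> (m + m')%MM = (v + a)%MM ->
    hess_weight R k l m m' != 0 -> m = v.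
  move=> ms ms' mm' w0.
  (* The weight is not symmetric: it vanishes when the first monomial lacks $X_k$, so the swapped
     pair [(a, v)] does not contribute. *)
  have mk0 : m k != 0%N.
    by apply: contraNneq w0 => mk0; rewrite /hess_weight mk0 !mul0r subr0.
  have := weightD k l r n m m'.
  rewrite mm' weightD vw.
  have aw : weight k l r n a = (n * r)%N by rewrite /weight al ak; lia.
  rewrite aw; have := under _ ms; have := under _ ms' => h' h e.
  have mw : weight k l r n m = (n * r)%N by lia.
  have mw' : weight k l r n m' = (n * r)%N by lia.
  have := congr1 (fun m : 'X_{1..2} => m k) mm'; rewrite /= !mnmDE ak addn0 => ek.
  have min m1 : m1 \in msupp H -> weight k l r n m1 = (n * r)%N ->
      m1 k != 0%N -> (v k <= m1 k)%N.
    move=> m1s m1w m1k; have := vmin m1; rewrite mem_filter m1s m1w eqxx m1k.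
    by move=> /(_ isT); move: m1w vw; rewrite /weight; nia.
  have mv := min _ ms mw mk0.
  have m'k : m' k = 0%N by lia.
  have ekv : m k = v k by lia.
  apply: (mnm2P kl) => //; move: mw vw; rewrite /weight ekv => <-.
  by move/addnI/eqP; rewrite eqn_pmul2l ?(ltnW n2) // => /eqP.
have /eqP := hess_coef_single kl hc va uniq.
rewrite !mulf_eq0 !mcoeff_eq0 vs as_ /= !orbF /hess_weight ak al !mul0r mulr0 subr0.
have nz i : (2 <= i)%N -> i%:R * (i%:R - 1) != 0 :> R.
  by move=> i2; rewrite mulf_neq0 ?subr_eq0 ?(eqr_nat R _ 1) ?pnatr_eq0; lia.
by rewrite mulf_eq0 !(negPf (nz _ _)) //; lia.
Qed.

Lemma constant_hessian_cases k l : k != l -> hessian k l H = c%:MP ->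
  [\/ affine H^`M(k), affine H^`M(l) |
   exists n, [/\ (3 <= n)%N, pure_deg l k n &
     exists2 v, v \in msupp H & v k = 1%N /\ v l = n.-1]].
Proof.
move=> kl hc.
have lk : l != k by rewrite eq_sym.
have hc' : hessian l k H = c%:MP by rewrite hessianC.
have [|[n n2 pk]] := pure_degP kl hc; first by constructor 1.
have [|[r r2 pl]] := pure_degP lk hc'; first by constructor 2.
have under := newton_under_line kl hc n2 r2 pk pl.
(* Under this line [H] has total degree at most 2. *)
have n2r2 : (n = 2 /\ r = 2)%N -> affine H^`M(k).
  move=> [nE rE] m m1; rewrite mcoeff_deriv; apply/eqP.
  rewrite mulrn_eq0 /= mcoeff_eq0; apply/negP => /under.
  rewrite nE rE /weight !mnmDE !mnm1E eqxx (negPf kl).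
  by move: m1; rewrite (mdeg2E _ kl); lia.
have [/n2r2|[v vs [vk vw]]] := newton_edge_neighbour kl hc n2 r2 pk pl.
  by constructor 1.
have [[rE nE]|[u us [ul uw]]] := newton_edge_neighbour lk hc' r2 n2 pl pk.
  by constructor 1; apply: n2r2.
(* The neighbours $(1,j)$ and $(i,1)$ of the two ends satisfy $r + nj = nr$ and $n + ri = nr$, so
   each of [n], [r] divides the other. *)
have nr : n = r.
  move: vw uw; rewrite /weight vk ul !muln1 => vw uw.
  have rd : (r %| n)%N.
    have : (r %| r * n)%N by apply: dvdn_mulr.
    by rewrite -uw dvdn_addl // dvdn_mulr.
  have nd : (n %| r)%N.
    have : (n %| n * r)%N by apply: dvdn_mulr.
    by rewrite -vw dvdn_addl // dvdn_mulr.
  by apply/eqP; rewrite eqn_dvd nd rd.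
subst r; have [nE|n3] := eqVneq n 2%N; first by constructor 1; apply: n2r2.
constructor 3; exists n; split => //; first by lia.
exists v => //; split => //; move: vw; rewrite /weight vk.
have -> : (n * n = n * 1 + n * n.-1)%N by rewrite -mulnDr; congr (_ * _)%N; lia.
by move/addnI/eqP; rewrite eqn_pmul2l ?(ltnW n2) // => /eqP.
Qed.

End NewtonPolygon.

(** * Antiderivatives and potentials *)

Section Primitive.
Variables (R : numFieldType) (n : nat).
Implicit Types p : {mpoly R[n]}.

(** Integrating with zero constant brings in no variable besides $X_i$; the second clause lets one
    partial derivative be corrected without disturbing another. *)
Lemma mpoly_primitive (i : 'I_n) p :
  exists2 P, P^`M(i) = p & forall j, j != i -> p^`M(j) = 0 -> P^`M(j) = 0.
Proof.
pose J : {mpoly R[n]} := \sum_(m : 'X_{1..n < msize p}) (p@_m / (m i).+1%:R) *: 'X_[m].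
have JE m : J@_m = p@_m / (m i).+1%:R.
  have [lt|le] := ltnP (mdeg m) (msize p).
    exact: (mcoeff_mpoly (fun m : 'X_{1..n} => p@_m / (m i).+1%:R) lt).
  rewrite (memN_msupp_eq0 (msize_mdeg_ge le)) mul0r raddf_sum big1 //= => d _.
  rewrite mcoeffZ mcoeffX; case: eqP => [dE|]; last by rewrite mulr0.
  by move: (bmdeg d); rewrite dE ltnNge le.
exists ('X_i * J) => [|j ji pj0].
  apply/mpolyP => m; rewrite mcoeff_deriv mcoeffXUM mnmDE mnm1E eqxx addn1 /= addmK.
  by rewrite JE -[_ *+ (m i).+1]mulr_natr mulfVK // pnatr_eq0.
suff Jj0 : J^`M(j) = 0.
  by rewrite mderivM Jj0 mderivX mnm1E eq_sym (negPf ji) scale0r mul0r mulr0 addr0.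
apply/mpolyP => m; rewrite mcoeff_deriv JE mcoeff0.
by rewrite -mulrnAl -mcoeff_deriv pj0 mcoeff0 mul0r.
Qed.

(** Integrate [u] along $X_l$ to get $P$. The error $P_k + v$ is free of $X_l$ by hypothesis, so its
    primitive along $X_k$ can be subtracted while keeping $P_l = u$. *)
Lemma mpoly_potential (k l : 'I_n) (u v : {mpoly R[n]}) : l != k ->
  u^`M(k) = - v^`M(l) -> exists2 H, H^`M(l) = u & H^`M(k) = - v.
Proof.
move=> lk uv; have [P Pl _] := mpoly_primitive l u.
have [W Wk Wl] := mpoly_primitive k (P^`M(k) + v).
exists (P - W); rewrite mderivB.
  by rewrite Wl ?subr0 // mderivD mderiv_comm Pl uv addNr.
by rewrite Wk opprD addNKr.
Qed.

End Primitive.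

(** * Planar maps with constant trace and determinant, and shears *)

Section ConstantCharPoly.
Variable R : numFieldType.
Implicit Types (p q : {mpoly R[2]}) (a t d : R).

(** A monomial of degree at least two is divisible by some $X_i X_j$, and in characteristic zero
    differentiation keeps its coefficient nonzero. *)
Lemma affineP p : affine p <-> forall i j, p^`M(i)^`M(j) = 0.
Proof.
split=> [hp i j|h m m1].
  apply/mpolyP => m; rewrite !mcoeff_deriv hp ?mul0rn ?mcoeff0 //.
  by rewrite !mdegD !mdeg1; lia.
have [i [m' mE]] := mnm_split (ltnW m1).
have [|j [m'' mE']] := @mnm_split _ m'.
  by move: m1; rewrite mE mdegD mdeg1; lia.
have /eqP := congr1 (mcoeff m'') (h i j).
by rewrite mcoeff0 !mcoeff_deriv !mulrn_eq0 /= -mE' -mE => /eqP.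
Qed.

(** Only the right half of a conjugation; the left half replaces the second coordinate $q$ by $q -
    ap$. *)
Definition shear a p : {mpoly R[2]} :=
  p \mPo [tuple 'X_0; 'X_1 + a *: 'X_0].

Lemma shear_ind (P : {mpoly R[2]} -> Prop) :
  (forall c, P c%:MP) -> P 'X_0 -> P 'X_1 ->
  (forall p q, P p -> P q -> P (p + q)) ->
  (forall p q, P p -> P q -> P (p * q)) -> forall p, P p.
Proof.
move=> PC P0 P1 PD PM; apply: mpoly_alg_ind => // i.
by have [->|->] := @ord2_cases 0 1 i isT.
Qed.

Lemma shearK a : cancel (shear a) (shear (- a)).
Proof.
apply: shear_ind => [c||||]; rewrite /shear.
- by rewrite !comp_mpolyC.
- by rewrite !comp_mpolyXU.
- rewrite comp_mpolyXU /= comp_mpolyD comp_mpolyZ !comp_mpolyXU /=.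
  by rewrite scaleNr subrK.
- by move=> p q hp hq; rewrite !comp_mpolyD hp hq.
- by move=> p q hp hq; rewrite !rmorphM /= hp hq.
Qed.

Lemma mderiv1_shear a p : (shear a p)^`M(1) = shear a p^`M(1).
Proof.
rewrite /shear; elim/shear_ind: p => [c|||p q hp hq|p q hp hq].
- by rewrite comp_mpolyC !mderivC comp_mpoly0.
- by rewrite comp_mpolyXU /= !mderivXX comp_mpoly0.
- by rewrite comp_mpolyXU /= mderivD mderivZ !mderivXX scaler0 addr0 comp_mpoly1.
- by rewrite !(comp_mpolyD, mderivD) hp hq.
- by rewrite rmorphM /= !mderivM !comp_mpolyD !rmorphM /= hp hq.
Qed.

Lemma mderiv0_shear a p :
  (shear a p)^`M(0) = shear a p^`M(0) + a *: shear a p^`M(1).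
Proof.
rewrite /shear; elim/shear_ind: p => [c|||p q hp hq|p q hp hq].
- by rewrite comp_mpolyC !mderivC comp_mpoly0 scaler0 addr0.
- by rewrite comp_mpolyXU /= !mderivXX comp_mpoly0 comp_mpoly1 scaler0 addr0.
- by rewrite comp_mpolyXU /= mderivD mderivZ !mderivXX comp_mpoly0 comp_mpoly1.
- by rewrite !(comp_mpolyD, mderivD) hp hq scalerDr addrACA.
- rewrite rmorphM /= !mderivM !comp_mpolyD !rmorphM /= hp hq.
  by rewrite mulrDl mulrDr scalerDr -scalerAl -scalerAr addrACA.
Qed.

Lemma affine_shear a p : affine p -> affine (shear a p).
Proof.
move/affineP => h; apply/affineP.
have s0 i j : shear a p^`M(i)^`M(j) = 0 by rewrite h /shear comp_mpoly0.
move=> i j; have [->|->] := @ord2_cases 0 1 i isT;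
  have [->|->] := @ord2_cases 0 1 j isT;
  by rewrite !(mderiv0_shear, mderiv1_shear, mderivD, mderivZ, s0, scaler0, addr0).
Qed.

Lemma affine_of_shear a p : affine (shear a p) -> affine p.
Proof. by move/(affine_shear (- a)); rewrite shearK. Qed.

(** The shear fixes the line $x = 0$ pointwise, hence preserves $p(0,y)$. Formally, it commutes with
    the $y$-derivative and keeps the constant term. *)
Lemma mcoeff_shear_pure a p e : (shear a p)@_(U_(1) *+ e) = p@_(U_(1) *+ e).
Proof.
elim: e p => [|e IH] p.
  rewrite mulm0n; rewrite /shear; elim/shear_ind: p => [c|||p q hp hq|p q hp hq].
  - by rewrite comp_mpolyC.
  - by rewrite comp_mpolyXU.
  - rewrite comp_mpolyXU /=; by rewrite mcoeffD mcoeffZ !mcoeffX !mnm1_eq0 mulr0 addr0.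
  - by rewrite comp_mpolyD !mcoeffD hp hq.
  - by rewrite rmorphM /= !rmorphM /= hp hq.
have := IH p^`M(1); rewrite -mderiv1_shear !mcoeff_deriv.
have -> : (U_(1) *+ e + U_(1) = U_(1) *+ e.+1 :> 'X_{1..2})%MM.
  by rewrite mulmSr.
rewrite -[LHS]mulr_natr -[RHS]mulr_natr; apply: mulIf.
by rewrite pnatr_eq0.
Qed.

(** In the last case the potential $H$ contains $y^{e+1}$ and $xy^e$, which show up as $y^e$ in $p$
    and $q$ because $p = H_y$ and $q = -H_x$ up to linear terms. *)
Lemma planar_cases p q t d :
  p^`M(0) + q^`M(1) = t%:MP -> p^`M(0) * q^`M(1) - p^`M(1) * q^`M(0) = d%:MP ->
  [\/ affine p, affine q |
   exists e, [/\ (2 <= e)%N, p@_(U_(1) *+ e) != 0,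
     forall e', (e < e')%N -> p@_(U_(1) *+ e') = 0 & q@_(U_(1) *+ e) != 0]].
Proof.
move=> trE detE.
have [s tE] : exists s, t = s + s by exists (t / 2); rewrite -splitr.
pose u := p - s *: 'X_0; pose v := q - s *: 'X_1.
have u0 : u^`M(0) = p^`M(0) - s%:MP.
  by rewrite mderivB mderivZ mderivXX eqxx -mul_mpolyC mulr1.
have v1 : v^`M(1) = q^`M(1) - s%:MP.
  by rewrite mderivB mderivZ mderivXX eqxx -mul_mpolyC mulr1.
have uv : u^`M(0) = - v^`M(1).
  apply/eqP; rewrite -addr_eq0 u0 v1 addrACA -opprD trE -mpolyCD -tE.
  by rewrite subrr.
have [H H1 H0] := @mpoly_potential R 2 0 1 u v isT uv.
(* The Hessian of $H$ is the Jacobian determinant of $(u,v)$, that is $d - st + s^2$ with $t =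
   2s$. *)
have hess : hessian 0 1 H = (d - s * s)%:MP.
  have u1 : u^`M(1) = p^`M(1).
    by rewrite mderivB mderivZ mderivXX scaler0 subr0.
  have v0 : v^`M(0) = q^`M(0).
    by rewrite mderivB mderivZ mderivXX scaler0 subr0.
  have pE : p^`M(0) = s%:MP + s%:MP - q^`M(1) by rewrite -mpolyCD -tE -trE addrK.
  rewrite /hessian H1 H0 !mderivN u1 v0 v1 mpolyCB mpolyCM -detE pE; ring.
have coefu e : (2 <= e)%N -> p@_(U_(1) *+ e) = H@_(U_(1) *+ e.+1) *+ e.+1.
  move=> e2; have := congr1 (mcoeff (U_(1) *+ e)%MM) H1.
  rewrite mcoeff_deriv mcoeffB mcoeffZ mcoeffX.
  have -> : (U_(0%R) == U_(1) *+ e :> 'X_{1..2})%MM = false.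
    by apply/eqP => /(congr1 (@mdeg 2)); rewrite mdegMn !mdeg1; lia.
  rewrite mulr0 subr0 => <-; rewrite mulmnE mnm1E eqxx mul1n.
  by rewrite mulmSr.
have coefv e : (2 <= e)%N -> q@_(U_(1) *+ e) = - H@_(U_(0%R) + U_(1) *+ e).
  move=> e2; have := congr1 (mcoeff (U_(1) *+ e)%MM) H0.
  rewrite mcoeff_deriv mcoeffN mcoeffB mcoeffZ mcoeffX.
  have -> : (U_(1) == U_(1) *+ e :> 'X_{1..2})%MM = false.
    by apply/eqP => /(congr1 (@mdeg 2)); rewrite mdegMn !mdeg1; lia.
  by rewrite mulr0 subr0 mulmnE mnm1E mul0n mulr1n addmC => ->; rewrite opprK.
have [] := @constant_hessian_cases _ _ _ 0 1 isT hess.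
- rewrite H0 => /affineN; rewrite opprK => /affineD/(_ (affineZX s 1)).
  by rewrite subrK; constructor 2.
- by rewrite H1 => /affineD/(_ (affineZX s 0)); rewrite subrK; constructor 1.
case=> n [n3 [[m ms [m1 m0]] mmax] [w ws [w0 w1]]]; constructor 3.
have mE : m = (U_(1) *+ n)%MM.
  by apply: (@mnm2P 0 1) => //; rewrite ?m0 ?m1 mulmnE mnm1E ?mul1n.
have wE : w = (U_(0%R) + U_(1) *+ n.-1)%MM.
  by apply: (@mnm2P 0 1) => //; rewrite ?w0 ?w1 mnmDE mulmnE !mnm1E ?mul1n.
exists n.-1; split; first by lia.
- by rewrite coefu ?prednK ?mulrn_eq0 -?mE ?mcoeff_eq0 ?ms //; lia.
- move=> e' ne; rewrite coefu ?memN_msupp_eq0 ?mul0rn //; last by lia.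
  apply/negP => /mmax; rewrite !mulmnE !mnm1E mul0n mul1n.
  by move=> /(_ erefl); lia.
- by rewrite coefv ?oppr_eq0 -?wE ?mcoeff_eq0 ?ws //; lia.
Qed.

(* In the remaining case of [planar_cases], conjugating by the shear
   [(x, y + a x)] removes the offending monomial from the second coordinate. *)
Lemma planar_affine_combination p q t d :
  p^`M(0) + q^`M(1) = t%:MP -> p^`M(0) * q^`M(1) - p^`M(1) * q^`M(0) = d%:MP ->
  affine p \/ exists a, affine (q - a *: p).
Proof.
move=> trE detE; have [|haff|] := planar_cases trE detE; first by left.
  by right; exists 0; rewrite scale0r subr0.
(* This [a] cancels $y^e$ in $q - ap$. *)
case=> e [e2 pe0 pe qe0]; pose a := q@_(U_(1) *+ e) / p@_(U_(1) *+ e).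
(* The pair is conjugate to $(p,q)$, so trace and determinant persist. *)
pose p' := shear a p; pose q' := shear a (q - a *: p).
have shearD f g : shear a (f + g) = shear a f + shear a g by exact: comp_mpolyD.
have shearZ c f : shear a (c *: f) = c *: shear a f by exact: comp_mpolyZ.
have shearB f g : shear a (f - g) = shear a f - shear a g by exact: comp_mpolyB.
have shearM f g : shear a (f * g) = shear a f * shear a g by exact: rmorphM.
have trE' : p'^`M(0) + q'^`M(1) = t%:MP.
  rewrite mderiv0_shear mderiv1_shear mderivB mderivZ shearB shearZ.
  by rewrite addrACA subrr addr0 -shearD trE /shear comp_mpolyC.
have detE' : p'^`M(0) * q'^`M(1) - p'^`M(1) * q'^`M(0) = d%:MP.
  have -> : d%:MP = shear a d%:MP by rewrite /shear comp_mpolyC.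
  rewrite -detE shearB !shearM !mderiv0_shear !mderiv1_shear !mderivB !mderivZ.
  by rewrite !shearB !shearZ -!mul_mpolyC; ring.
have [/affine_of_shear|/affine_of_shear|] := planar_cases trE' detE'.
- by left.
- by right; exists a.
case=> e' [_]; rewrite !mcoeff_shear_pure => pe'0 pe'.
(* Pure powers of $y$ survive the shear, so [p'] and [p] share the largest one; but [q'] has no
   $y^e$. *)
have -> : e' = e.
  case: (ltngtP e' e) => // [/pe'|/pe] h; last by rewrite h eqxx in pe'0.
  by rewrite mcoeff_shear_pure in h; rewrite h eqxx in pe0.
by rewrite mcoeffB mcoeffZ /a divfK // subrr eqxx.
Qed.

End ConstantCharPoly.

(** * Bounded polynomials are constant *)

Section Bounded.
Variable R : realFieldType.

(** If [p] is nonconstant with positive leading coefficient, [p - C] has the same leading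
    coefficient and is eventually positive. *)
Lemma bounded_poly_const (p : {poly R}) (C : R) :
  (forall x, `|p.[x]| <= C) -> (size p <= 1)%N.
Proof.
wlog lc_gt0 : p / 0 < lead_coef p => [wlg|] bnd.
  have [->|p0] := eqVneq p 0; first by rewrite size_poly0.
  have [lt|lt|/eqP] := ltrgtP (lead_coef p) 0; last by rewrite lead_coef_eq0 (negPf p0).
  - rewrite -size_polyN; apply: wlg => [|x]; first by rewrite lead_coefN oppr_gt0.
    by rewrite hornerN normrN.
  - exact: wlg.
rewrite leqNgt; apply/negP => szp.
have szC : (size (- C%:P)%R < size p)%N.
  by rewrite size_polyN (leq_ltn_trans (size_polyC_leq1 _)).
have := @poly_pinfty_gt_lc _ (p - C%:P); rewrite lead_coefDl // => /(_ lc_gt0)[x hx].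
have := hx x (lexx x); rewrite hornerD hornerN hornerC.
have := le_trans (ler_norm _) (bnd x).
by rewrite -subr_le0 => h /(lt_le_trans lc_gt0); rewrite ltNge h.
Qed.

(* Kronecker's substitution [x := s, y := s ^+ B] separates the monomials of [p]
   as soon as [B] exceeds the degree. *)
Lemma bounded_mpoly_const (p : {mpoly R[2]}) (C : R) :
  (forall v, `|p.@[v]| <= C) -> exists c, p = c%:MP.
Proof.
move=> bnd; pose B := msize p.
pose w (i : 'I_2) := if i == 0 then 1%N else B.
pose W (m : 'X_{1..2}) := (m 0%R + m 1%R * B)%N.
pose K : {poly R} := \sum_(m <- msupp p) p@_m *: 'X^(W m).
have KE s : K.[s] = p.@[fun i => s ^+ w i].
  rewrite mevalE horner_sum; apply: eq_bigr => m _.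
  rewrite hornerZ hornerXn !big_ord_recl big_ord0 mulr1 -!exprM -exprD.
  congr (_ * _ ^+ _); rewrite /W /w /= mul1n mulnC; congr (_ + _ * m _)%N.
  exact: val_inj.
have Wm m : (m \in msupp p) -> (m 0%R < B)%N.
  move/msize_mdeg_lt; apply: leq_ltn_trans.
  by rewrite (@mdeg2E 0 1) // leq_addr.
have Kcoef m : m \in msupp p -> K`_(W m) = p@_m.
  move=> ms; rewrite coef_sum (bigD1_seq m) //= coefZ coefXn eqxx mulr1.
  rewrite big_seq_cond big1 ?addr0 // => m' /andP[m's m'm].
  rewrite coefZ coefXn; case: eqP => [WE|]; last by rewrite mulr0.
  have B0 : (0 < B)%N := leq_ltn_trans (leq0n _) (Wm _ ms).
  (* The exponents of $x$ are below [B], so division of [W] by [B] returns them as remainders and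
     those of $y$ as quotients. *)
  case/eqP: m'm; have e0 := congr1 (modn^~ B) WE; have e1 := congr1 (divn^~ B) WE.
  rewrite /W /= ![(_ + _ * B)%N]addnC !modnMDl !modn_small ?Wm // in e0.
  rewrite /W /= ![(_ + _ * B)%N]addnC !divnMDl // !divn_small ?Wm // !addn0 in e1.
  exact: (@mnm2P 0 1).
have szK : (size K <= 1)%N.
  by apply: (@bounded_poly_const _ C) => s; rewrite KE.
exists p@_0; apply/mpolyP => m; rewrite mcoeffC.
have [->|m0] := eqVneq m 0%MM; first by rewrite mulr1.
rewrite mulr0; apply/eqP; rewrite mcoeff_eq0; apply/negP => ms.
have : K`_(W m) != 0 by rewrite Kcoef // -mcoeff_msupp.
case/eqP; rewrite nth_default // (leq_trans szK) // lt0n; apply: contra m0.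
have B0 : (0 < B)%N := leq_ltn_trans (leq0n _) (Wm _ ms).
rewrite /W addn_eq0 muln_eq0 (gtn_eqF B0) orbF => /andP[/eqP e0 /eqP e1].
by apply/eqP; apply: (@mnm2P 0 1); rewrite ?mnm0E.
Qed.

End Bounded.

(** * Eigenvalues of 2 by 2 matrices and the conclusion *)

Lemma det_mx2 (R : comNzRingType) (A : 'M[R]_2) :
  \det A = A 0 0 * A 1 1 - A 0 1 * A 1 0.
Proof.
rewrite (expand_det_row _ 0) !big_ord_recl big_ord0 addr0 /cofactor !det_mx11 !mxE.
have -> : lift ord0 ord0 = 1 :> 'I_2 by apply: val_inj.
have -> : lift 1 0 = 0 :> 'I_2 by apply: val_inj.
by rewrite /= expr0 expr1 mul1r mulN1r mulrN.
Qed.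

Lemma mxtrace2 (R : nzRingType) (A : 'M[R]_2) : \tr A = A 0 0 + A 1 1.
Proof.
rewrite /mxtrace !big_ord_recl big_ord0 addr0; congr (_ + A _ _);
  exact: val_inj.
Qed.

(** Over the algebraically closed [R[i]] the characteristic polynomial is $(X - z_1)(X - z_2)$;
    trace and determinant are $z_1 + z_2$ and $z_1 z_2$. *)
Lemma eigenvalue_bound_trace_det (R : rcfType) (A : 'M[R]_2) :
  (forall z : R[i], eigenvalue (map_mx (real_complex R) A) z -> `|z| <= 1) ->
  `|\tr A| <= 2 /\ `|\det A| <= 1.
Proof.
set M := map_mx _ A => bnd.
have [r rE] := closed_field_poly_normal (char_poly M).
rewrite (monicP (char_poly_monic M)) scale1r in rE.
have szr : size r = 2.
  by apply/eqP; rewrite -eqSS -(size_prod_XsubC r id) -rE size_char_poly.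
case: r szr rE => [|z1 [|z2 []]] // _; rewrite !big_cons big_nil mulr1 => rE.
have b1 : `|z1| <= 1.
  by apply: bnd; rewrite eigenvalue_root_char rE rootM root_XsubC eqxx.
have b2 : `|z2| <= 1.
  by apply: bnd; rewrite eigenvalue_root_char rE rootM !root_XsubC eqxx orbT.
have normE (x : R) : `|x%:C| = `|x|%:C.
  by rewrite normc_def /= expr0n addr0 sqrtr_sqr.
have qE : ('X - z1%:P) * ('X - z2%:P) = 'X^2 - (z1 + z2) *: 'X + (z1 * z2)%:P.
  by rewrite -mul_polyC !rmorphE /=; ring.
have trE : (\tr A)%:C = z1 + z2.
  have := char_poly_trace M isT; rewrite rE qE trace_map_mx !coefE /= => /eqP.
  by rewrite mulr1 sub0r addr0 eqr_opp => /eqP <-.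
have detE : (\det A)%:C = z1 * z2.
  have := char_poly_det M; rewrite rE qE det_map_mx !coefE /=.
  by rewrite mulr0 sub0r oppr0 add0r sqrrN expr1n mul1r.
rewrite -!lecR -!normE trE detE normrM; split.
  by rewrite (le_trans (ler_normD _ _)) // rmorphD rmorph1 lerD.
by rewrite rmorph1 mulr_ile1.
Qed.

(** The factor [a] is nonzero because [q] is, so the quotient would be the constant [a^-1]. *)
Lemma nonconstant_quotient_not_proportional (R : fieldType) n
    (p q : {mpoly R[n]}) (a : R) :
  nonconstant_quotient p q -> q <> a *: p.
Proof.
case=> p0 q0 quot qE; have a0 : a != 0.
  by apply: contraNneq q0 => a0; rewrite qE a0 scale0r.
have pE : p = (a^-1)%:MP * q by rewrite qE mul_mpolyC scalerA mulVf // scale1r.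
apply: (quot a^-1); rewrite {1}pE rmorphM /= mulfK //.
by rewrite tofrac_eq0.
Qed.

Theorem corollary2p2 (R : realType) (F : 'I_2 -> {mpoly R[2]}) :
  nonconstant_quotient (nonlinear_part (F 0)) (nonlinear_part (F 1)) ->
  exists (v : 'I_2 -> R) (z : R[i]),
    eigenvalue (map_mx (real_complex R) (jacobian_mx F v)) z /\ 1 <= `|z|.
Proof.
move=> quot; apply: boolp.contrapT => none.
have bnd v z : eigenvalue (map_mx (real_complex R) (jacobian_mx F v)) z -> `|z| <= 1.
  move=> ez; rewrite ltW // real_ltNge ?real1 ?normr_real //.
  by apply/negP => z1; apply: none; exists v, z.
have [t trE] : exists t, (F 0)^`M(0) + (F 1)^`M(1) = t%:MP.
  apply: (@bounded_mpoly_const _ _ 2) => v.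
  have [+ _] := eigenvalue_bound_trace_det (bnd v).
  by rewrite mxtrace2 !mxE mevalD.
have [d detE] : exists d,
    (F 0)^`M(0) * (F 1)^`M(1) - (F 0)^`M(1) * (F 1)^`M(0) = d%:MP.
  apply: (@bounded_mpoly_const _ _ 1) => v.
  have [_] := eigenvalue_bound_trace_det (bnd v).
  by rewrite det_mx2 !mxE mevalB !mevalM.
have [aff|[a aff]] := planar_affine_combination trE detE.
- by case: quot => /eqP p0 _ _; apply: p0; apply: nonlinear_part_affine.
- apply: (nonconstant_quotient_not_proportional (a := a) quot).
  (* [F 1] and [a *: F 0] agree in every degree above one, so the nonlinear parts are
     proportional. *)
  apply/mpolyP => m; rewrite mcoeffZ !mcoeff_nonlinear_part.
  case: ifP => [m1|]; last by rewrite mulr0.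
  by apply/eqP; rewrite -subr_eq0 -mcoeffZ -mcoeffB aff.
Qed.
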